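(* Let $n\ge 1$ and let $k\ge 2$ be even. A directed graph with underlying graph $GG_{n,k}$ is the chained ice configuration corresponding to some chained alternating sign matrix in $ASM^{\circ}_{n,k}$ if and only if it has chained domain wall boundary conditions and each interior vertex has exactly two edges entering and two edges leaving.
   Context: For $n,k\ge1$, $ASM^{\circ}_{n,k}$ (chained circular alternating sign matrices) is the set of $k$-tuples $(A^{(1)},\dots,A^{(k)})$ of $n\times n$ matrices with entries in $\{-1,0,1\}$ satisfying: (i) $\sum_{j=1}^m A^{(\ell)}_{i,j}\in\{0,1\}$ for all $1\le i,m\le n$, $1\le\ell\le k$; (ii) $\sum_{j=1}^n A^{(\ell-1)}_{i,j}+\sum_{j=1}^m A^{(\ell)}_{n+1-j,i}\in\{0,1\}$ for all $1\le i,m\le n$, $1\le\ell\le k$, where $A^{(0)}=A^{(k)}$; (iii) the sum of all entries $\sum_{i,j,\ell}A^{(\ell)}_{i,j}$ is maximum among all such $k$-tuples satisfying (i) and (ii). Let $k$ be even. Superscripts are read cyclically modulo $k$. The chained grid graph $GG_{n,k}$ has interior vertices $v^{(\ell)}_{i,j}$ ($1\le i,j\le n$, $1\le\ell\le k$), boundary vertices $v^{(\ell)}_{0,j}$ and $v^{(\ell)}_{i,0}$ ($1\le i,j\le n$, $1\le\ell\le k$), and the following edges (for all $1\le\ell\le k$): - interior horizontal edges between $v^{(\ell)}_{i,j}$ and $v^{(\ell)}_{i,j+1}$, $1\le i\le n$, $1\le j<n$; - interior vertical edges between $v^{(\ell)}_{i,j}$ and $v^{(\ell)}_{i+1,j}$,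 $1\le i<n$, $1\le j\le n$; - chaining edges between $v^{(\ell)}_{i,n}$ and $v^{(\ell+1)}_{n,i}$, $1\le i\le n$, with $k+1\equiv 1$; - boundary edges between $v^{(\ell)}_{0,j}$ and $v^{(\ell)}_{1,j}$ and between $v^{(\ell)}_{i,0}$ and $v^{(\ell)}_{i,1}$, $1\le i,j\le n$. (For $k=2$ the two chaining edges joining $v^{(1)}_{n,n}$ and $v^{(2)}_{n,n}$ are distinct parallel edges. Each interior vertex has degree 4.) The chained ice configuration corresponding to $A\in ASM^{\circ}_{n,k}$ is the orientation of $GG_{n,k}$ given as follows, for all $1\le\ell\le k/2$. (1) Interior horizontal edges ($1\le i\le n$, $1\le j<n$): $v^{(2\ell-1)}_{i,j}\leftarrow v^{(2\ell-1)}_{i,j+1}$ if $\sum_{j_0=1}^j A^{(2\ell-1)}_{i,j_0}=1$, and $v^{(2\ell-1)}_{i,j}\rightarrow v^{(2\ell-1)}_{i,j+1}$ if this sum is $0$; $v^{(2\ell)}_{i,j}\rightarrow v^{(2\ell)}_{i,j+1}$ if $\sum_{j_0=1}^j A^{(2\ell)}_{i,j_0}=1$, and $v^{(2\ell)}_{i,j}\leftarrow v^{(2\ell)}_{i,j+1}$ if this sum is $0$. (2) Interior vertical edges ($1\le i<n$, $1\le j\le n$): $v^{(2\ell-1)}_{i,j}\leftarrow v^{(2\ell-1)}_{i+1,j}$ if $\sum_{j_0=1}^n A^{(2\ell-2)}_{j,j_0}+\sum_{j_0=1}^{n-i}A^{(2\ell-1)}_{n+1-j_0,j}=1$, and $v^{(2\ell-1)}_{i,j}\rightarrow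 v^{(2\ell-1)}_{i+1,j}$ if this sum is $0$; $v^{(2\ell)}_{i,j}\rightarrow v^{(2\ell)}_{i+1,j}$ if $\sum_{j_0=1}^n A^{(2\ell-1)}_{j,j_0}+\sum_{j_0=1}^{n-i}A^{(2\ell)}_{n+1-j_0,j}=1$, and $v^{(2\ell)}_{i,j}\leftarrow v^{(2\ell)}_{i+1,j}$ if this sum is $0$. (3) Chaining edges ($1\le i\le n$): $v^{(2\ell-1)}_{i,n}\leftarrow v^{(2\ell)}_{n,i}$ if $\sum_{j_0=1}^n A^{(2\ell-1)}_{i,j_0}=1$, and $v^{(2\ell-1)}_{i,n}\rightarrow v^{(2\ell)}_{n,i}$ if this sum is $0$; $v^{(2\ell)}_{i,n}\rightarrow v^{(2\ell+1)}_{n,i}$ if $\sum_{j_0=1}^n A^{(2\ell)}_{i,j_0}=1$, and $v^{(2\ell)}_{i,n}\leftarrow v^{(2\ell+1)}_{n,i}$ if this sum is $0$. (4) Boundary edges ($1\le i,j\le n$): $v^{(2\ell-1)}_{i,0}\rightarrow v^{(2\ell-1)}_{i,1}$, $v^{(2\ell-1)}_{0,j}\leftarrow v^{(2\ell-1)}_{1,j}$, $v^{(2\ell)}_{i,0}\leftarrow v^{(2\ell)}_{i,1}$, $v^{(2\ell)}_{0,j}\rightarrow v^{(2\ell)}_{1,j}$. The conditions in (4) on the orientation of the boundary edges are called chained domain wall boundary conditions. *)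

(* Defs.v *)
From HB Require Import structures.
From mathcomp Require Import all_boot all_order all_algebra.

Set Implicit Arguments.
Unset Strict Implicit.
Unset Printing Implicit Defensive.

Import GRing.Theory Num.Theory.
Local Open Scope ring_scope.

(* All indices are 0-based: the element x of 'I_n or 'I_k stands for the      *)
(* one-based index x.+1.  In particular the superscript (l) of a matrix or of *)
(* a vertex is odd iff [odd l.+1].  Superscripts are cyclic: their successor  *)
(* and predecessor are ordS and ord_pred.                                     *)

Section ChainedASM.
Variables n k : nat.
Implicit Types A B : 'I_k -> 'M[int]_n.

Definition row_psum A (l : 'I_k) (i : 'I_n) (m : nat) : int :=
  \sum_(j < n | (j < m)%N) A l i j.

(* The j-th entry of a column counted from the bottom is in row rev_ord j. *)
Definition col_psum A (l : 'I_k) (i : 'I_n) (m : nat) : int :=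
  \sum_(j < n) A (ord_pred l) i j
  + \sum_(j < n | (j < m)%N) A l (rev_ord j) i.

Definition pre_chained_asm A : Prop :=
  [/\ forall l i j, A l i j \in [:: -1; 0; 1],
      forall l i m, (1 <= m <= n)%N -> row_psum A l i m \in [:: 0; 1]
    & forall l i m, (1 <= m <= n)%N -> col_psum A l i m \in [:: 0; 1]].

Definition entry_sum A : int := \sum_(l < k) \sum_(i < n) \sum_(j < n) A l i j.

Definition chained_asm A : Prop :=
  pre_chained_asm A /\
  forall B, pre_chained_asm B -> entry_sum B <= entry_sum A.

End ChainedASM.

Section Ordinals.
Variable n : nat.

Lemma first_ord_proof (i : 'I_n) : (0 < n)%N.
Proof. exact: leq_ltn_trans (leq0n i) (ltn_ord i). Qed.

Lemma succ_ord_proof (i : 'I_n.-1) : (i.+1 < n)%N.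
Proof. by rewrite -ltn_predRL. Qed.

(* The argument of first_ord and last_ord only witnesses that 'I_n is         *)
(* inhabited.                                                                 *)
Definition first_ord (i : 'I_n) : 'I_n := Ordinal (first_ord_proof i).
Definition last_ord (i : 'I_n) : 'I_n := rev_ord (first_ord i).

Definition base_ord (i : 'I_n.-1) : 'I_n := widen_ord (leq_pred n) i.
Definition succ_ord (i : 'I_n.-1) : 'I_n := Ordinal (succ_ord_proof i).

End Ordinals.

Section ChainedGridGraph.
Variables n k : nat.

(* VTop l j is the boundary vertex v^(l)_{0,j}, and VLeft l i is v^(l)_{i,0}. *)
Inductive vertex : Type :=
| VInt of 'I_k & 'I_n & 'I_n
| VTop of 'I_k & 'I_n
| VLeft of 'I_k & 'I_n.

Inductive edge : Type :=
| EHor of 'I_k & 'I_n & 'I_n.-1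
| EVer of 'I_k & 'I_n.-1 & 'I_n
| EChain of 'I_k & 'I_n
| ETop of 'I_k & 'I_n
| ELeft of 'I_k & 'I_n.

Definition vertex_code (v : vertex) :
    ('I_k * 'I_n * 'I_n) + ('I_k * 'I_n) + ('I_k * 'I_n) :=
  match v with
  | VInt l i j => inl (inl (l, i, j))
  | VTop l j => inl (inr (l, j))
  | VLeft l i => inr (l, i)
  end.

Definition vertex_decode
    (c : ('I_k * 'I_n * 'I_n) + ('I_k * 'I_n) + ('I_k * 'I_n)) : vertex :=
  match c with
  | inl (inl (l, i, j)) => VInt l i j
  | inl (inr (l, j)) => VTop l j
  | inr (l, i) => VLeft l i
  end.

Lemma vertex_codeK : cancel vertex_code vertex_decode.
Proof. by case. Qed.

HB.instance Definition _ := Countable.copy vertex (can_type vertex_codeK).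
HB.instance Definition _ : isFinite vertex := CanIsFinite vertex_codeK.

Definition edge_code (e : edge) :
    ('I_k * 'I_n * 'I_n.-1) + ('I_k * 'I_n.-1 * 'I_n)
    + ('I_k * 'I_n) + ('I_k * 'I_n) + ('I_k * 'I_n) :=
  match e with
  | EHor l i j => inl (inl (inl (inl (l, i, j))))
  | EVer l i j => inl (inl (inl (inr (l, i, j))))
  | EChain l i => inl (inl (inr (l, i)))
  | ETop l j => inl (inr (l, j))
  | ELeft l i => inr (l, i)
  end.

Definition edge_decode
    (c : ('I_k * 'I_n * 'I_n.-1) + ('I_k * 'I_n.-1 * 'I_n)
         + ('I_k * 'I_n) + ('I_k * 'I_n) + ('I_k * 'I_n)) : edge :=
  match c with
  | inl (inl (inl (inl (l, i, j)))) => EHor l i j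
  | inl (inl (inl (inr (l, i, j)))) => EVer l i j
  | inl (inl (inr (l, i))) => EChain l i
  | inl (inr (l, j)) => ETop l j
  | inr (l, i) => ELeft l i
  end.

Lemma edge_codeK : cancel edge_code edge_decode.
Proof. by case. Qed.

HB.instance Definition _ := Countable.copy edge (can_type edge_codeK).
HB.instance Definition _ : isFinite edge := CanIsFinite edge_codeK.

(* The graph is a multigraph: distinct edges may have the same ends. *)
Definition ends (e : edge) : vertex * vertex :=
  match e with
  | EHor l i j => (VInt l i (base_ord j), VInt l i (succ_ord j))
  | EVer l i j => (VInt l (base_ord i) j, VInt l (succ_ord i) j)
  | EChain l i => (VInt l i (last_ord i), VInt (ordS l) (last_ord i) i)
  | ETop l j => (VTop l j, VInt l (first_ord j) j)
  | ELeft l i => (VLeft l i, VInt l i (first_ord i))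
  end.

(* A directed graph with underlying graph GG_{n,k}: the edge e is directed    *)
(* from (ends e).1 to (ends e).2 if D e is true, and conversely otherwise.    *)
Definition orientation := {ffun edge -> bool}.
Implicit Type D : orientation.

Definition edge_tail D (e : edge) : vertex :=
  if D e then (ends e).1 else (ends e).2.
Definition edge_head D (e : edge) : vertex :=
  if D e then (ends e).2 else (ends e).1.

Definition indegree D (v : vertex) : nat := #|[set e | edge_head D e == v]|.
Definition outdegree D (v : vertex) : nat := #|[set e | edge_tail D e == v]|.

Definition ice_rule D : Prop :=
  forall l i j,
    indegree D (VInt l i j) = 2%N /\ outdegree D (VInt l i j) = 2%N.

Definition chained_dwbc D : Prop :=
  forall (l : 'I_k) (i : 'I_n),
    D (ELeft l i) = odd l.+1 /\ D (ETop l i) = ~~ odd l.+1.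

(* In an odd superscript the edge follows its reference direction when the    *)
(* partial sum s is 0 and opposes it when s is 1; in an even superscript it   *)
(* is the other way around.                                                   *)
Definition edge_dir (l : 'I_k) (s : int) : bool :=
  if odd l.+1 then s == 0 else s == 1.

(* The vertical edge EVer l i j joins the one-based rows i.+1 and i.+2, hence *)
(* n - i.+1 entries of the column lie below it.                               *)
Definition ice_configuration (A : 'I_k -> 'M[int]_n) : orientation :=
  [ffun e => match e with
    | EHor l i j => edge_dir l (row_psum A l i j.+1)
    | EVer l i j => edge_dir l (col_psum A l j (n - i.+1))
    | EChain l i => edge_dir l (row_psum A l i n)
    | ETop l j => ~~ odd l.+1
    | ELeft l i => odd l.+1
    end].

End ChainedGridGraph.

(* Main.v *)
Require Import Defs.
From mathcomp Require Import all_boot all_order all_algebra.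
From mathcomp Require Import zify.

(** Both sides of the equivalence are statements about one 0/1 labelling of the
    edges. Label an edge 0 or 1 according to its direction, with the two
    directions exchanged between odd and even superscripts ([state]). In the
    ice configuration of a matrix tuple [A], the labels met along row [i] from
    left to right are the partial row sums of [A], from 0 at the left boundary
    to the full row sum on the chaining edge. The labels met along a column
    from bottom to top are the partial column sums, starting on the chaining
    edge with the row sum of the previous matrix.

    - At an interior vertex the convention makes two of the four edges enter
      exactly when right - left = top - bottom holds for the labels, whatever
      the parity of the superscript ([ice_ruleP]). The entry of [A] at that
      vertex is the common value: it is at once an increment of partial row
      sums and an increment of partial column sums. Hence a labelling with the
      boundary values satisfies the ice rule iff it consists of the partial
      sums of some [A] ([exists_psum_states]). As labels are 0 or 1, the
      partial sums then satisfy conditions (i) and (ii) of a chained matrix.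

    - The remaining boundary condition, label 1 on the top edges, is
      maximality. Adding up all the full column sums counts every entry twice,
      once in its column and once in its row ([entry_sum_double]). Each full
      column sum is at most 1, so the entry sum is at most kn/2; when k is even
      this bound is reached by taking the identity at odd superscripts and 0 at
      even ones. So [A] is maximal iff all its full column sums are 1
      ([chained_asmP]). *)

Set Implicit Arguments.
Unset Strict Implicit.
Unset Printing Implicit Defensive.

Import GRing.Theory Num.Theory.
Local Open Scope ring_scope.

(** * Rows and columns of edges *)

Section Lines.
Variables n k : nat.
Implicit Types (l : 'I_k) (i j : 'I_n) (D : orientation n k).

(** The edges of row [i], numbered from left to right by [0 <= m <= n]: the
    boundary edge, the interior edges, then the chaining edge. *)
Definition hedge l i (m : nat) : edge n k :=
  if m is r.+1 then
    if insub r is Some j then EHor l i j else EChain l i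
  else ELeft l i.

(** The edges of column [j], numbered from bottom to top like the partial
    column sums: the chaining edge from the previous superscript, the interior
    edges, then the boundary edge. *)
Definition vedge l j (m : nat) : edge n k :=
  if (n - m)%N is r.+1 then
    if insub r is Some i then EVer l i j else EChain (ord_pred l) j
  else ETop l j.

Arguments hedge : simpl never.
Arguments vedge : simpl never.

Lemma hedge_EHor l i (j : 'I_n.-1) : hedge l i j.+1 = EHor l i j.
Proof. by rewrite /hedge valK. Qed.

Lemma hedge_EChain l i : hedge l i n = EChain l i.
Proof.
rewrite /hedge; case: n i => [[]//|r] i.
by rewrite insubN // ltnn.
Qed.

Lemma vedge_EVer l (i : 'I_n.-1) j : vedge l j (n - i.+1) = EVer l i j.
Proof.
have lt_in : (i.+1 <= n)%N by have := ltn_ord i; lia.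
by rewrite /vedge subKn // valK.
Qed.

Lemma vedge_EChain l j : vedge l j 0 = EChain (ord_pred l) j.
Proof.
rewrite /vedge subn0; case: n j => [[]//|r] j.
by rewrite insubN // ltnn.
Qed.

Lemma vedge_ETop l j : vedge l j n = ETop l j.
Proof. by rewrite /vedge subnn. Qed.

Definition level (e : edge n k) : 'I_k :=
  match e with
  | EHor l _ _ | EVer l _ _ | EChain l _ | ETop l _ | ELeft l _ => l
  end.

(** The 0/1 label of an edge; this inverts [edge_dir]. A chaining edge takes
    the parity of the superscript whose row it ends. *)
Definition state D (e : edge n k) : bool := D e (+) odd (level e).+1.

Lemma edge_dir_bit l (b : bool) : edge_dir l (b : nat)%:Z = b (+) odd l.+1.
Proof. by rewrite /edge_dir; case: (odd _); case: b. Qed.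

Lemma chained_dwbcP D :
  chained_dwbc D <->
  forall l i, state D (hedge l i 0) = false /\ state D (vedge l i n) = true.
Proof.
split=> dwbc l i; have := dwbc l i; rewrite vedge_ETop /state /=.
  by case=> -> ->; case: (odd l).
by case: (D _) (D _) => [] []; case: (odd l) => /= -[].
Qed.

Lemma eq_VInt l i j l' i' j' :
  (VInt l i j == VInt l' i' j' :> vertex n k) = [&& l == l', i == i' & j == j'].
Proof. by apply/eqP/and3P => [[-> -> ->] | [/eqP-> /eqP-> /eqP->]]. Qed.

(** * The ice rule in terms of labels *)

(** [b] tells whether [e] enters [v]; the second half says that [e] has
    exactly one end at [v]. *)
Definition meets_as D e (v : vertex n k) (b : bool) :=
  (edge_head D e == v = b) /\ (edge_tail D e == v = ~~ b).

Lemma meets_asE D e (v : vertex n k) (b : bool) :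
    ((ends e).2 == v) = b -> ((ends e).1 == v) = ~~ b ->
  meets_as D e v (D e == b).
Proof.
rewrite /meets_as /edge_head /edge_tail.
by case: (D e) => /= -> ->; case: b.
Qed.

Hypothesis k_even : ~~ odd k.

Lemma odd_ordS l : odd (ordS l) = ~~ odd l.
Proof. by rewrite /= odd_mod //; apply: negbTE. Qed.

Lemma odd_ord_pred l : odd (ord_pred l) = ~~ odd l.
Proof. by rewrite -{2}[l]ord_predK odd_ordS negbK. Qed.

Lemma ord_pred_neq l : (ord_pred l == l) = false.
Proof.
by apply/negP => /eqP eq_l; have := odd_ord_pred l; rewrite eq_l; case: odd.
Qed.

Lemma left_edge_meets D l i j :
  meets_as D (hedge l i j) (VInt l i j) (state D (hedge l i j) (+) odd l.+1).
Proof.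
have [j0 | j_gt0] := posnP j.
  have -> : hedge l i j = ELeft l i by rewrite j0.
  rewrite /state addbK -[D _]eqb_id.
  apply: meets_asE => //=.
  by rewrite eq_VInt !eqxx -val_eqE /= j0.
have lt_r : (j.-1 < n.-1)%N by have := ltn_ord j; lia.
have -> : hedge l i j = EHor l i (Ordinal lt_r).
  by rewrite -hedge_EHor /=; congr hedge; lia.
rewrite /state addbK -[D _]eqb_id.
by apply: meets_asE; rewrite /= eq_VInt !eqxx -val_eqE /=; lia.
Qed.

Lemma right_edge_meets D l i j :
  meets_as D (hedge l i j.+1) (VInt l i j) (state D (hedge l i j.+1) (+) odd l).
Proof.
have [lt_j | ge_j] := ltnP j n.-1.
  have -> : hedge l i j.+1 = EHor l i (Ordinal lt_j) by rewrite -hedge_EHor.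
  rewrite /state /= addbN addNb addbK -eqbF_neg.
  by apply: meets_asE; rewrite /= eq_VInt !eqxx -val_eqE /=; lia.
have jn : j.+1 = n by have := ltn_ord j; lia.
rewrite jn hedge_EChain /state /= addbN addNb addbK -eqbF_neg.
apply: meets_asE; rewrite /= eq_VInt.
  by rewrite -(inj_eq (@ord_pred_inj k)) ordSK eq_sym ord_pred_neq.
by rewrite !eqxx -val_eqE /=; lia.
Qed.

Lemma top_edge_meets D l i j :
  meets_as D (vedge l j (rev_ord i).+1) (VInt l i j)
    (state D (vedge l j (rev_ord i).+1) (+) odd l.+1).
Proof.
have lt_i := ltn_ord i.
have [i0 | i_gt0] := posnP i.
  have -> : vedge l j (rev_ord i).+1 = ETop l j.
    by rewrite -vedge_ETop /=; congr vedge; lia.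
  rewrite /state addbK -[D _]eqb_id.
  apply: meets_asE => //=.
  by rewrite eq_VInt !eqxx -val_eqE /= i0.
have lt_r : (i.-1 < n.-1)%N by lia.
have -> : vedge l j (rev_ord i).+1 = EVer l (Ordinal lt_r) j.
  by rewrite -vedge_EVer /=; congr vedge; lia.
rewrite /state addbK -[D _]eqb_id.
by apply: meets_asE; rewrite /= eq_VInt !eqxx -val_eqE /=; lia.
Qed.

(** The parity of [k] matters here. The chaining edge below the last row is
    labelled with the parity of the previous superscript and has its second
    end at the vertex, while the interior vertical edges have the parity of
    [l] and their first end there: the two differences cancel. *)
Lemma bottom_edge_meets D l i j :
  meets_as D (vedge l j (rev_ord i)) (VInt l i j)
    (state D (vedge l j (rev_ord i)) (+) odd l).
Proof.
have lt_i := ltn_ord i.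
have [lt_r | ge_i] := ltnP i n.-1.
  have -> : vedge l j (rev_ord i) = EVer l (Ordinal lt_r) j.
    by rewrite -vedge_EVer.
  rewrite /state /= addbN addNb addbK -eqbF_neg.
  by apply: meets_asE; rewrite /= eq_VInt !eqxx -val_eqE /=; lia.
have -> : vedge l j (rev_ord i) = EChain (ord_pred l) j.
  by rewrite -vedge_EChain /=; congr vedge; lia.
rewrite /state /= odd_ord_pred negbK addbK -[D _]eqb_id.
apply: meets_asE; rewrite /= eq_VInt; last by rewrite ord_pred_neq.
by rewrite ord_predK !eqxx -val_eqE /=; lia.
Qed.

(** The left, right, bottom and top edges at the vertex [VInt l i j]. *)
Definition star l i j : seq (edge n k) :=
  [:: hedge l i j; hedge l i j.+1; vedge l j (rev_ord i);
      vedge l j (rev_ord i).+1].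

Lemma hedge_inj l i m m' :
  (m <= n)%N -> (m' <= n)%N -> hedge l i m = hedge l i m' -> m = m'.
Proof.
pose pos (e : edge n k) : nat :=
  match e with EHor _ _ j => j.+1 | EChain _ _ => n | _ => 0%N end.
have posK r : (r <= n)%N -> pos (hedge l i r) = r.
  case: r => [//|r] lt_r; rewrite /hedge.
  case: insubP => [j _ /= -> // | ge_r /=]; lia.
by move=> /posK {2}<- /posK {2}<- ->.
Qed.

Lemma vedge_inj l j m m' :
  (m <= n)%N -> (m' <= n)%N -> vedge l j m = vedge l j m' -> m = m'.
Proof.
pose pos (e : edge n k) : nat :=
  match e with EVer _ i _ => (n - i.+1)%N | ETop _ _ => n | _ => 0%N end.
have posK r : (r <= n)%N -> pos (vedge l j r) = r.
  move=> le_r; rewrite /vedge; case eq_r: (n - r)%N => [|s] /=; first lia.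
  case: insubP => [i _ /= -> | ge_s /=]; lia.
by move=> /posK {2}<- /posK {2}<- ->.
Qed.

(** A row and a column of the same superscript could only share a chaining
    edge, but those lie at the superscripts [l] and [ord_pred l], which have
    different parities. *)
Lemma hedge_neq_vedge l i j m m' : hedge l i m != vedge l j m'.
Proof.
pose vertical (e : edge n k) :=
  match e with
  | EVer _ _ _ | ETop _ _ => true | EChain l' _ => l' != l | _ => false
  end.
apply: contraFneq (_ : vertical (hedge l i m) = false); last first.
  by case: m => [//|m]; rewrite /hedge; case: insub => //=; rewrite eqxx.
move=> ->; rewrite /vedge; case: (n - m')%N => [//|r].
by case: insub => //=; rewrite ord_pred_neq.
Qed.

Lemma star_uniq l i j : uniq (star l i j).
Proof.
rewrite /= !inE !negb_or !hedge_neq_vedge !andbT /=.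
apply/andP; split; apply/eqP; [move/hedge_inj|move/vedge_inj].
- by have := ltn_ord j; lia.
- by rewrite /=; have := ltn_ord i; lia.
Qed.

Lemma star_complete l i j e :
  ((ends e).1 == VInt l i j) || ((ends e).2 == VInt l i j) -> e \in star l i j.
Proof.
case: e => [l' i' j'|l' i' j'|l' i'|l' i'|l' i'] /=; rewrite ?eq_VInt !inE.
- rewrite -!hedge_EHor.
  by case/orP => /and3P[/eqP<- /eqP<- /eqP<-] /=; rewrite eqxx ?orbT.
- rewrite -!vedge_EVer.
  case/orP => /and3P[/eqP<- /eqP<- /eqP<-] /=; rewrite ?eqxx ?orbT //.
  suff -> : (n - i'.+2).+1 = (n - i'.+1)%N by rewrite eqxx !orbT.
  by have := ltn_ord i'; lia.
- case/orP => /and3P[/eqP<- /eqP<- /eqP<-] /=.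
    have -> : (n - 1).+1 = n by have := ltn_ord i'; lia.
    by rewrite hedge_EChain eqxx orbT.
  have -> : (n - (n - 1).+1)%N = 0%N by lia.
  by rewrite vedge_EChain ordSK eqxx !orbT.
- case/and3P=> [/eqP<- /eqP<- /eqP<-] /=.
  have -> : (n - 1).+1 = n by have := ltn_ord i'; lia.
  by rewrite vedge_ETop eqxx !orbT.
- case/and3P=> [/eqP<- /eqP<- /eqP<-] /=.
  by rewrite eqxx.
Qed.

Lemma card_star l i j (P : pred (edge n k)) :
    (forall e, P e -> ((ends e).1 == VInt l i j) || ((ends e).2 == VInt l i j)) ->
  #|[set e | P e]| = count P (star l i j).
Proof.
move=> P_star; rewrite -size_filter.
have /card_uniqP <- := filter_uniq P (star_uniq l i j).
apply: eq_card => e; rewrite inE mem_filter.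
by case Pe: (P e) => //=; rewrite star_complete // P_star.
Qed.

(** At an odd superscript, which is an even [l : 'I_k], the left and top edges
    enter the vertex when labelled 0, the right and bottom edges when labelled
    1, so that the indegree is 2 + right - left - (top - bottom); at an even
    superscript this is the outdegree. *)
Lemma ice_ruleP D :
  ice_rule D <->
  forall l i j,
    (state D (hedge l i j.+1) : nat)%:Z - (state D (hedge l i j) : nat)%:Z
    = (state D (vedge l j (rev_ord i).+1) : nat)%:Z
      - (state D (vedge l j (rev_ord i)) : nat)%:Z.
Proof.
suff vertexP l i j :
    indegree D (VInt l i j) = 2%N /\ outdegree D (VInt l i j) = 2%N <->
    (state D (hedge l i j.+1) : nat)%:Z - (state D (hedge l i j) : nat)%:Z
    = (state D (vedge l j (rev_ord i).+1) : nat)%:Z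
      - (state D (vedge l j (rev_ord i)) : nat)%:Z.
  by split=> ice l i j; apply/vertexP.
rewrite /indegree /outdegree !(@card_star l i j); first last.
- by rewrite /edge_head => e; case: (D e) => ->; rewrite ?orbT.
- by rewrite /edge_tail => e; case: (D e) => ->; rewrite ?orbT.
have [hL tL] := left_edge_meets D l i j.
have [hR tR] := right_edge_meets D l i j.
have [hT tT] := top_edge_meets D l i j.
have [hB tB] := bottom_edge_meets D l i j.
rewrite /= hL tL hR tR hT tT hB tB /=.
by case: (odd l); do 4![case: (state D _)]; split => // -[].
Qed.

End Lines.

(** * Partial sums and maximality *)

Section PartialSums.
Variables n k : nat.
Implicit Types (A : 'I_k -> 'M[int]_n) (l : 'I_k) (i j : 'I_n).

Lemma sum_ord_ltS (F : 'I_n -> int) (m : 'I_n) :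
  \sum_(j < n | (j < m.+1)%N) F j = \sum_(j < n | (j < m)%N) F j + F m.
Proof.
rewrite (bigD1 m) //= addrC; congr (_ + _); apply: eq_bigl => j.
by rewrite -val_eqE /=; lia.
Qed.

Lemma row_psumS A l i j : row_psum A l i j.+1 = row_psum A l i j + A l i j.
Proof. exact: sum_ord_ltS. Qed.

Lemma col_psumS A l i j :
  col_psum A l i j.+1 = col_psum A l i j + A l (rev_ord j) i.
Proof. by rewrite /col_psum sum_ord_ltS addrA. Qed.

Lemma row_psum0 A l i : row_psum A l i 0 = 0.
Proof. exact: big_pred0. Qed.

Lemma row_psum_full A l i : row_psum A l i n = \sum_(j < n) A l i j.
Proof. by apply: eq_bigl => j; rewrite ltn_ord. Qed.

Lemma col_psum0 A l i : col_psum A l i 0 = row_psum A (ord_pred l) i n.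
Proof.
by rewrite /col_psum (big_pred0 _ _ _ _ (fun=> erefl)) addr0 row_psum_full.
Qed.

Lemma col_psum_full A l i :
  col_psum A l i n
  = \sum_(j < n) A (ord_pred l) i j + \sum_(j < n) A l j i.
Proof.
rewrite /col_psum; congr (_ + _); rewrite [RHS](reindex_inj rev_ord_inj) /=.
by apply: eq_bigl => j; rewrite ltn_ord.
Qed.

(** An entry of [A l] lies in one column of [A l] and in one row of [A l], the
    latter being counted in a full column sum of the next superscript. *)
Lemma entry_sum_double A :
  entry_sum A *+ 2 = \sum_(l < k) \sum_(i < n) col_psum A l i n.
Proof.
under [RHS]eq_bigr => l _.
  under eq_bigr do rewrite col_psum_full.
  rewrite big_split /= [X in _ + X]exchange_big /=; over.
rewrite big_split mulr2n /=; congr (_ + _).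
exact: (reindex_inj (@ord_pred_inj k)).
Qed.

Lemma in01P (x : int) :
  reflect (exists b : bool, x = (b : nat)%:Z) (x \in [:: 0; 1]).
Proof.
rewrite !inE; apply: (iffP orP) => [[/eqP-> | /eqP->] | [[] ->]].
- by exists false.
- by exists true.
- by right.
- by left.
Qed.

(** A tuple of maximal entry sum. *)
Definition half_identity l : 'M[int]_n := if odd l.+1 then 1%:M else 0.

Hypothesis k_even : ~~ odd k.

Lemma half_identity_row_psum l i m :
  row_psum half_identity l i m = (odd l.+1 && (i < m)%N : nat)%:Z.
Proof.
rewrite /row_psum /half_identity; case: (odd l.+1) => /=; last first.
  by apply: big1 => j _; rewrite mxE.
under eq_bigr do rewrite mxE.
rewrite big_mkcond (bigD1 i) //= eqxx big1 ?addr0; first by case: (i < m)%N.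
by move=> j; rewrite eq_sym => /negPf->; case: (_ < _)%N.
Qed.

Lemma half_identity_col_psum l i m :
  col_psum half_identity l i m = (~~ odd l.+1 || (rev_ord i < m)%N : nat)%:Z.
Proof.
rewrite /col_psum -row_psum_full half_identity_row_psum ltn_ord andbT.
rewrite /= odd_ord_pred // negbK /half_identity /=.
case: (odd l) => /=.
  by rewrite big1 ?addr0 // => j _; rewrite mxE.
under eq_bigr do rewrite mxE.
rewrite add0r big_mkcond (bigD1 (rev_ord i)) //= rev_ordK eqxx big1 ?addr0.
  by case: (_ < m)%N.
move=> j; rewrite -(inj_eq rev_ord_inj) rev_ordK => /negPf->.
by case: (_ < _)%N.
Qed.

Lemma half_identity_pre : pre_chained_asm half_identity.
Proof.
split=> [l i j | l i m _ | l i m _].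
- rewrite /half_identity; case: (odd _); rewrite mxE ?inE //.
  by case: (i == j).
- by apply/in01P; rewrite half_identity_row_psum; eexists.
- by apply/in01P; rewrite half_identity_col_psum; eexists.
Qed.

Lemma half_identity_col_full l i : col_psum half_identity l i n = 1.
Proof. by rewrite half_identity_col_psum ltn_ord orbT. Qed.

(** Twice the entry sum is a sum of full column sums, each at most 1. Since
    [half_identity] makes all of them equal to 1, the maximum is reached
    exactly when every one of these inequalities is an equality. *)
Lemma chained_asmP A :
  chained_asm A <->
  pre_chained_asm A /\ forall l i, col_psum A l i n = 1.
Proof.
have col_le1 B : pre_chained_asm B -> forall l i, col_psum B l i n <= 1.
  case=> _ _ colB l i.
  have : (1 <= n <= n)%N by rewrite leqnn andbT (leq_ltn_trans _ (ltn_ord i)).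
  by move/(colB l i)/in01P => [b ->]; case: b.
have sum_le (B C : 'I_k -> 'M[int]_n) :
    (entry_sum B <= entry_sum C) =
    (\sum_(l < k) \sum_(i < n) col_psum B l i n
      <= \sum_(l < k) \sum_(i < n) col_psum C l i n).
  by rewrite -!entry_sum_double lerMn2r.
split=> [[preA maxA] | [preA fullA]]; split=> //; last first.
  move=> B preB; rewrite sum_le; apply: ler_sum => l _; apply: ler_sum => i _.
  by rewrite fullA; apply: col_le1.
have gap_ge0 l i :
    0 <= col_psum half_identity l i n - col_psum A l i n.
  by rewrite half_identity_col_full subr_ge0 col_le1.
have := maxA _ half_identity_pre; rewrite sum_le -subr_le0 -!sumrB.
move=> gap_le0 l i.
have sum0 : \sum_(l < k) \sum_(i < n)
    (col_psum half_identity l i n - col_psum A l i n) = 0.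
  apply/eqP; rewrite Order.POrderTheory.eq_le sumr_ge0 ?andbT => [|l' _].
    by under eq_bigr do rewrite sumrB.
  exact: sumr_ge0.
have row0 : \sum_(i < n) (col_psum half_identity l i n - col_psum A l i n) = 0.
  by apply: (psumr_eq0P _ sum0) => // l' _; apply: sumr_ge0.
apply/eqP; rewrite eq_sym -subr_eq0 -(half_identity_col_full l i).
by apply/eqP; apply: (psumr_eq0P _ row0).
Qed.

End PartialSums.

(** * Labels as partial sums *)

Section Correspondence.
Variables n k : nat.
Implicit Types (A : 'I_k -> 'M[int]_n) (l : 'I_k) (i j : 'I_n).
Implicit Types (D : orientation n k).
Hypothesis k_even : ~~ odd k.

Definition psum_states A D :=
  (forall l i m, (m <= n)%N ->
     row_psum A l i m = (state D (hedge l i m) : nat)%:Z)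
  /\ (forall l i m, (m <= n)%N ->
     col_psum A l i m = (state D (vedge l i m) : nat)%:Z).

Lemma ice_configuration_states A :
    pre_chained_asm A -> (forall l i, col_psum A l i n = 1) ->
  psum_states A (ice_configuration A).
Proof.
case=> _ rowA colA fullA.
have rowE l i m : (m <= n)%N -> row_psum A l i m
    = (state (ice_configuration A) (hedge l i m) : nat)%:Z.
  move=> le_m; have [m0 | m_gt0] := posnP m.
    by rewrite m0 row_psum0 /state ffunE /= addbb.
  have /(rowA l i)/in01P[b Eb] : (1 <= m <= n)%N by rewrite m_gt0.
  rewrite Eb; congr Posz; have [lt_m | ge_m] := ltnP m n.
    have lt_r : (m.-1 < n.-1)%N by lia.
    have Em : m = (Ordinal lt_r).+1 by rewrite /= prednK.
    by rewrite Em hedge_EHor /state ffunE -Em Eb edge_dir_bit addbK.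
  have Em : m = n by lia.
  by rewrite Em in Eb *; rewrite hedge_EChain /state ffunE Eb edge_dir_bit addbK.
split=> // l i m le_m; have [m0 | m_gt0] := posnP m.
  by rewrite m0 col_psum0 rowE // vedge_EChain hedge_EChain.
have [lt_m | ge_m] := ltnP m n; last first.
  have -> : m = n by lia.
  by rewrite fullA vedge_ETop /state ffunE /= negbK addbN addbb.
have /(colA l i)/in01P[b Eb] : (1 <= m <= n)%N by rewrite m_gt0.
have lt_r : (n - m.+1 < n.-1)%N by lia.
have Em : m = (n - (Ordinal lt_r).+1)%N by rewrite /=; lia.
rewrite Eb; congr Posz.
by rewrite Em vedge_EVer /state ffunE -Em Eb edge_dir_bit addbK.
Qed.

(** From right to left, the partial sums of [A] lie in {0, 1} because they are
    labels, and the boundary labels 1 make [A] maximal; the labels determine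
    [D], which therefore is the ice configuration. *)
Lemma psum_statesP A D :
  (chained_asm A /\ D = ice_configuration A)
  <-> (psum_states A D /\ chained_dwbc D).
Proof.
rewrite chained_asmP // chained_dwbcP.
split=> [[[preA fullA] ->] | [[rowA colA] dwbc]].
  have states := ice_configuration_states preA fullA.
  split=> // l i; have [rowE colE] := states.
  have := rowE l i 0 (leq0n n); have := colE l i n (leqnn n).
  by rewrite row_psum0 fullA; do 2!case: (state _ _).
have fullA l i : col_psum A l i n = 1.
  by rewrite colA // (dwbc l i).2.
split.
  split=> //.
  split=> [l i j | l i m /andP[_ le_m] | l i m /andP[_ le_m]].
  - have -> : A l i j = row_psum A l i j.+1 - row_psum A l i j.
      by rewrite row_psumS addrAC subrr add0r.
    rewrite !rowA ?ltn_ord // 1?ltnW ?ltn_ord //.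
    by do 2!case: (state _ _).
  - by apply/in01P; rewrite rowA //; eexists.
  - by apply/in01P; rewrite colA //; eexists.
apply/ffunP => e; rewrite ffunE; case: e => [l i j|l i j|l i|l i|l i].
- rewrite rowA; last by have := ltn_ord j; lia.
  by rewrite hedge_EHor edge_dir_bit addbK.
- by rewrite colA ?leq_subr // vedge_EVer edge_dir_bit addbK.
- by rewrite rowA // hedge_EChain edge_dir_bit addbK.
- have := (dwbc l i).2; rewrite vedge_ETop /state /=.
  by case: (D _); case: (odd l).
- have := (dwbc l i).1; rewrite /state /=.
  by case: (D _); case: (odd l).
Qed.

(** The increments of the labels along the rows define [A], so the row labels
    are its partial row sums; by the ice rule the same entries are the
    increments along the columns. *)
Lemma exists_psum_states D :
  chained_dwbc D -> (exists A, psum_states A D) <-> ice_rule D.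
Proof.
move/chained_dwbcP => dwbc; rewrite ice_ruleP //.
split=> [[A [rowA colA]] l i j | ice].
  have lt_j := ltn_ord j; have lt_i := ltn_ord (rev_ord i).
  rewrite -!rowA -?colA // 1?ltnW // row_psumS col_psumS rev_ordK.
  by rewrite ![_ + A _ _ _]addrC !addrK.
pose A l : 'M[int]_n := \matrix_(i, j)
  ((state D (hedge l i j.+1) : nat)%:Z - (state D (hedge l i j) : nat)%:Z).
have rowA l i m :
    (m <= n)%N -> row_psum A l i m = (state D (hedge l i m) : nat)%:Z.
  elim: m => [_ | m IH lt_m]; first by rewrite row_psum0 (dwbc l i).1.
  rewrite (row_psumS A l i (Ordinal lt_m)) /= IH 1?ltnW // mxE /=.
  by rewrite addrC subrK.
exists A; split=> // l i; elim=> [_ | m IH lt_m].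
  by rewrite col_psum0 rowA // vedge_EChain hedge_EChain.
rewrite (col_psumS A l i (Ordinal lt_m)) [col_psum _ _ _ _]IH 1?ltnW // mxE ice.
by rewrite rev_ordK /= addrC subrK.
Qed.

End Correspondence.

Theorem theorem4p21 (n k : nat) (n_ge1 : (1 <= n)%N) (k_ge2 : (2 <= k)%N)
    (k_even : ~~ odd k) (D : orientation n k) :
  (exists A : 'I_k -> 'M[int]_n, chained_asm A /\ D = ice_configuration A)
  <-> (chained_dwbc D /\ ice_rule D).
Proof.
split=> [[A /(psum_statesP k_even)[states dwbc]] | [dwbc ice]].
  by split=> //; apply/(exists_psum_states k_even dwbc); exists A.
have /(exists_psum_states k_even dwbc)[A states] := ice.
by exists A; apply/(psum_statesP k_even).
Qed.
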